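(* Assume that there is a countable transitive model of $\mathsf{ZFC}$. Let $\mathbf{J}$ be an intermediate logic that is characterised by a class of finite trees, i.e. there is a class $\mathcal{K}$ of finite trees with $\mathbf{L}(\mathcal{K})=\mathbf{J}$. Then $\mathsf{CZF}$ has the de Jongh property with respect to $\mathbf{J}$, i.e. $\mathbf{L}(\mathsf{CZF}(\mathbf{J}))=\mathbf{J}$.
   Context: The meta-theory is classical $\mathsf{ZFC}$ (together with the existence of a countable transitive model of $\mathsf{ZFC}$). Propositional logic. Fix a countable set $\mathrm{Prop}$ of propositional variables. A propositional logic is identified with the set of formulas it proves. $\mathbf{IPC}$ and $\mathbf{CPC}$ are intuitionistic and classical propositional logic; an intermediate logic is a logic $\mathbf{J}$ with $\mathbf{IPC}\subseteq\mathbf{J}\subseteq\mathbf{CPC}$. Kripke frames. A Kripke frame is a partial order $(K,\leq)$. It is a tree if for every $v\in K$ the set $\{w\in K: w\leq v\}$ is well-ordered by $<$ and there is $r\in K$ with $r\leq v$ for all $v\in K$. It is finite if $K$ is finite. A valuation on $K$ is a map $V:\mathrm{Prop}\to\mathcal{P}(K)$ such that $w\in V(p)$ and $w\leq v$ imply $v\in V(p)$. Forcing: $v\Vdash p$ iff $v\in V(p)$; $v\Vdash\phi\wedge\psi$ iff $v\Vdash\phi$ and $v\Vdash\psi$; $v\Vdash\phi\vee\psi$ iff $v\Vdash\phi$ or $v\Vdash\psi$; $v\Vdash\phi\to\psi$ iff for all $w\geq v$, $w\Vdash\phi$ implies $w\Vdash\psi$; $v\Vdash\bot$ never. A formula is valid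 in $K$ if it is forced at every node under every valuation on $K$. For a class $\mathcal{K}$ of frames, $\mathbf{L}(\mathcal{K})$ is the set of formulas valid in all frames in $\mathcal{K}$; $\mathcal{K}$ characterises $\mathbf{J}$ if $\mathbf{L}(\mathcal{K})=\mathbf{J}$. De Jongh property. Let $\mathsf{T}$ be a theory based on intuitionistic predicate logic in a language $\mathcal{L}$. For $\sigma:\mathrm{Prop}\to\mathcal{L}^{\mathrm{sent}}$ (the $\mathcal{L}$-sentences), $\phi^\sigma$ is obtained from $\phi$ by replacing each variable $p$ by $\sigma(p)$. $\mathbf{L}(\mathsf{T})$ is the set of propositional formulas $\phi$ with $\mathsf{T}\vdash\phi^\sigma$ for all $\sigma$. $\mathsf{T}(\mathbf{J})$ is the closure of $\mathsf{T}$ under $\mathbf{J}$, i.e. $\mathsf{T}$ together with all $\phi^\sigma$ for $\phi\in\mathbf{J}$ and all $\sigma$. $\mathsf{T}$ has the de Jongh property with respect to $\mathbf{J}$ if $\mathbf{L}(\mathsf{T}(\mathbf{J}))=\mathbf{J}$. $\mathsf{CZF}$ is Aczel's constructive Zermelo–Fraenkel set theory, a theory in intuitionistic predicate logic in the language $\mathcal{L}_\in$ of set theory: Extensionality, Empty set, Pairing, Union, Infinity, Set Induction for all formulas, Separation for bounded formulas, Strong Collection, and Subset Collection. It is a subtheory of intuitionistic Zermelo–Fraenkel set theory $\mathsf{IZF}$, i.e. the intuitionistic theory with the axioms of Extensionality, Empty set, Pairing, Union, Power set, Infinity, and the full schemes of Set Induction, Separation and Collection. *)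

(* Defs.v *)
(* Built on Stdlib only. *)
From Stdlib Require Import List Arith Relations FinFun.
Import ListNotations.

(** * Propositional logic *)

Inductive pform : Type :=
| PVar (p : nat)
| PBot
| PAnd (A B : pform)
| POr (A B : pform)
| PImp (A B : pform).

Fixpoint psubst (s : nat -> pform) (A : pform) : pform :=
  match A with
  | PVar p => s p
  | PBot => PBot
  | PAnd A B => PAnd (psubst s A) (psubst s B)
  | POr A B => POr (psubst s A) (psubst s B)
  | PImp A B => PImp (psubst s A) (psubst s B)
  end.

(* Intuitionistic natural deduction from additional axioms [Ax]. *)
Inductive pprv (Ax : pform -> Prop) : list pform -> pform -> Prop :=
| pAx G A : Ax A -> pprv Ax G A
| pHyp G A : In A G -> pprv Ax G A
| pBotE G A : pprv Ax G PBot -> pprv Ax G A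
| pAndI G A B : pprv Ax G A -> pprv Ax G B -> pprv Ax G (PAnd A B)
| pAndE1 G A B : pprv Ax G (PAnd A B) -> pprv Ax G A
| pAndE2 G A B : pprv Ax G (PAnd A B) -> pprv Ax G B
| pOrI1 G A B : pprv Ax G A -> pprv Ax G (POr A B)
| pOrI2 G A B : pprv Ax G B -> pprv Ax G (POr A B)
| pOrE G A B C :
    pprv Ax G (POr A B) -> pprv Ax (A :: G) C -> pprv Ax (B :: G) C ->
    pprv Ax G C
| pImpI G A B : pprv Ax (A :: G) B -> pprv Ax G (PImp A B)
| pImpE G A B : pprv Ax G (PImp A B) -> pprv Ax G A -> pprv Ax G B.

Definition IPC (A : pform) : Prop := pprv (fun _ => False) [] A.

Definition CPC (A : pform) : Prop :=
  pprv (fun C => exists B, C = POr B (PImp B PBot)) [] A.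

Record propositional_logic (J : pform -> Prop) : Prop := {
  logic_mp : forall A B, J (PImp A B) -> J A -> J B;
  logic_subst : forall s A, J A -> J (psubst s A)
}.

Record intermediate_logic (J : pform -> Prop) : Prop := {
  interm_logic : propositional_logic J;
  interm_IPC : forall A, IPC A -> J A;
  interm_CPC : forall A, J A -> CPC A
}.

(** * Kripke frames *)

Record frame : Type := {
  node :> Type;
  fle : relation node;
  fle_order : order node fle
}.

Arguments fle {_} _ _.

Definition valuation (K : frame) (V : nat -> K -> Prop) : Prop :=
  forall p w v, V p w -> fle w v -> V p v.

Fixpoint forces {K : frame} (V : nat -> K -> Prop) (v : K) (A : pform) : Prop :=
  match A with
  | PVar p => V p v
  | PBot => False
  | PAnd A B => forces V v A /\ forces V v B
  | POr A B => forces V v A \/ forces V v B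
  | PImp A B => forall w, fle v w -> forces V w A -> forces V w B
  end.

Definition valid (K : frame) (A : pform) : Prop :=
  forall V, valuation K V -> forall v : K, forces V v A.

(* For a partial order, being a well-order amounts to every nonempty subset
   having a least element; linearity is the case of two-element subsets. *)
Definition well_ordered {T : Type} (le : relation T) (S : T -> Prop) : Prop :=
  forall P : T -> Prop,
    (forall w, P w -> S w) -> (exists w, P w) ->
    exists m, P m /\ forall w, P w -> le m w.

Definition is_tree (K : frame) : Prop :=
  (forall v : K, well_ordered fle (fun w => fle w v)) /\
  (exists r : K, forall v : K, fle r v).

Definition logic_of_frames (C : frame -> Prop) (A : pform) : Prop :=
  forall K, C K -> valid K A.

Definition characterises (C : frame -> Prop) (J : pform -> Prop) : Prop :=
  forall A, logic_of_frames C A <-> J A.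

(** * First-order logic in the language of set theory

    De Bruijn syntax; the only terms are variables, so substitution is
    renaming. *)

Inductive form : Type :=
| Mem (x y : nat)
| Eq (x y : nat)
| Bot
| And (A B : form)
| Or (A B : form)
| Imp (A B : form)
| All (A : form)
| Ex (A : form).

Definition Neg A := Imp A Bot.
Definition Iff A B := And (Imp A B) (Imp B A).

(* In [BAll a A] and [BEx a A] the variable [a] is read outside the binder,
   so the bounding set is never the bound variable itself. *)
Definition BAll (a : nat) (A : form) := All (Imp (Mem 0 (S a)) A).
Definition BEx (a : nat) (A : form) := Ex (And (Mem 0 (S a)) A).

Definition up (r : nat -> nat) (n : nat) : nat :=
  match n with 0 => 0 | S n => S (r n) end.

Fixpoint ren (r : nat -> nat) (A : form) : form :=
  match A with
  | Mem x y => Mem (r x) (r y)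
  | Eq x y => Eq (r x) (r y)
  | Bot => Bot
  | And A B => And (ren r A) (ren r B)
  | Or A B => Or (ren r A) (ren r B)
  | Imp A B => Imp (ren r A) (ren r B)
  | All A => All (ren (up r) A)
  | Ex A => Ex (ren (up r) A)
  end.

Definition shift (A : form) : form := ren S A.

Definition inst (A : form) (t : nat) : form :=
  ren (fun n => match n with 0 => t | S n => n end) A.

(* Strict upper bound on the free variables. *)
Fixpoint fvb (A : form) : nat :=
  match A with
  | Mem x y | Eq x y => S (Nat.max x y)
  | Bot => 0
  | And A B | Or A B | Imp A B => Nat.max (fvb A) (fvb B)
  | All A | Ex A => pred (fvb A)
  end.

Definition sentence (A : form) : Prop := fvb A = 0.

Definition univ_closure (A : form) : form := Nat.iter (fvb A) All A.

(* Intuitionistic predicate logic with equality. *)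
Inductive prv : list form -> form -> Prop :=
| Hyp G A : In A G -> prv G A
| BotE G A : prv G Bot -> prv G A
| AndI G A B : prv G A -> prv G B -> prv G (And A B)
| AndE1 G A B : prv G (And A B) -> prv G A
| AndE2 G A B : prv G (And A B) -> prv G B
| OrI1 G A B : prv G A -> prv G (Or A B)
| OrI2 G A B : prv G B -> prv G (Or A B)
| OrE G A B C : prv G (Or A B) -> prv (A :: G) C -> prv (B :: G) C -> prv G C
| ImpI G A B : prv (A :: G) B -> prv G (Imp A B)
| ImpE G A B : prv G (Imp A B) -> prv G A -> prv G B
| AllI G A : prv (map shift G) A -> prv G (All A)
| AllE G A t : prv G (All A) -> prv G (inst A t)
| ExI G A t : prv G (inst A t) -> prv G (Ex A)
| ExE G A C : prv G (Ex A) -> prv (A :: map shift G) (shift C) -> prv G C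
| EqI G t : prv G (Eq t t)
| EqE G A s t : prv G (Eq s t) -> prv G (inst A s) -> prv G (inst A t).

(* A theory is given by its set of axioms. *)
Definition theory := form -> Prop.

Definition proves (T : theory) (A : form) : Prop :=
  exists G, (forall B, In B G -> T B) /\ prv G A.

(** * Axioms

    In the schemes, a formula [A] has its distinguished variables as indices
    0, 1, ... in the order in which they are written in [A(x, y, ...)]; its
    remaining variables are parameters, closed off by [univ_closure].
    [place l k A] is [A] with its distinguished variables replaced by [l], read
    in a context of [k] binders that capture none of the parameters. *)

Definition place (l : list nat) (k : nat) (A : form) : form :=
  ren (fun n => nth n l (n - length l + k)) A.

(* forall a b, (forall x, x in a <-> x in b) -> a = b *)
Definition ax_extensionality : form :=
  All (All (Imp (All (Iff (Mem 0 2) (Mem 0 1))) (Eq 1 0))).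

(* exists a, forall x in a, false *)
Definition ax_empty : form := Ex (BAll 0 Bot).

(* forall a b, exists y, forall x, x in y <-> x = a \/ x = b *)
Definition ax_pairing : form :=
  All (All (Ex (All (Iff (Mem 0 1) (Or (Eq 0 3) (Eq 0 2)))))).

(* forall a, exists y, forall x, x in y <-> exists u in a, x in u *)
Definition ax_union : form :=
  All (Ex (All (Iff (Mem 0 1) (BEx 2 (Mem 1 0))))).

(* exists a, forall x, x in a <->
     (forall z, z notin x) \/
     exists y in a, forall z, z in x <-> z in y \/ z = y *)
Definition ax_infinity : form :=
  Ex (All (Iff (Mem 0 1)
    (Or (All (Neg (Mem 0 1)))
        (BEx 1 (All (Iff (Mem 0 2) (Or (Mem 0 1) (Eq 0 1)))))))).

(* (forall a, (forall x in a, A(x)) -> A(a)) -> forall a, A(a) *)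
Definition ax_set_induction (A : form) : form :=
  Imp (All (Imp (BAll 0 (place [0] 2 A)) (place [0] 1 A)))
      (All (place [0] 1 A)).

(* forall a, exists y, forall x, x in y <-> x in a /\ A(x) *)
Definition ax_separation (A : form) : form :=
  All (Ex (All (Iff (Mem 0 1) (And (Mem 0 2) (place [0] 3 A))))).

(* forall a, (forall x in a, exists y, A(x, y)) ->
     exists b, (forall x in a, exists y in b, A(x, y)) /\
               (forall y in b, exists x in a, A(x, y)) *)
Definition ax_strong_collection (A : form) : form :=
  All (Imp (BAll 0 (Ex (place [1; 0] 3 A)))
    (Ex (And (BAll 1 (BEx 1 (place [1; 0] 4 A)))
             (BAll 0 (BEx 2 (place [0; 1] 4 A)))))).

(* forall a b, exists c, forall u, (forall x in a, exists y in b, A(x, y, u)) ->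
     exists d in c, (forall x in a, exists y in d, A(x, y, u)) /\
                    (forall y in d, exists x in a, A(x, y, u)) *)
Definition ax_subset_collection (A : form) : form :=
  All (All (Ex (All (Imp (BAll 3 (BEx 3 (place [1; 0; 2] 6 A)))
    (BEx 1 (And (BAll 4 (BEx 1 (place [1; 0; 3] 7 A)))
                (BAll 0 (BEx 5 (place [0; 1; 3] 7 A))))))))).

Inductive bounded : form -> Prop :=
| bounded_Mem x y : bounded (Mem x y)
| bounded_Eq x y : bounded (Eq x y)
| bounded_Bot : bounded Bot
| bounded_And A B : bounded A -> bounded B -> bounded (And A B)
| bounded_Or A B : bounded A -> bounded B -> bounded (Or A B)
| bounded_Imp A B : bounded A -> bounded B -> bounded (Imp A B)
| bounded_BAll a A : bounded A -> bounded (BAll a A)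
| bounded_BEx a A : bounded A -> bounded (BEx a A).

Inductive CZF : theory :=
| CZF_extensionality : CZF ax_extensionality
| CZF_empty : CZF ax_empty
| CZF_pairing : CZF ax_pairing
| CZF_union : CZF ax_union
| CZF_infinity : CZF ax_infinity
| CZF_set_induction A : CZF (univ_closure (ax_set_induction A))
| CZF_bounded_separation A :
    bounded A -> CZF (univ_closure (ax_separation A))
| CZF_strong_collection A : CZF (univ_closure (ax_strong_collection A))
| CZF_subset_collection A : CZF (univ_closure (ax_subset_collection A)).

(* forall a, (exists x, x in a) -> exists x in a, ~ exists y in x, y in a *)
Definition ax_foundation : form :=
  All (Imp (Ex (Mem 0 1)) (BEx 0 (Neg (BEx 0 (Mem 0 2))))).

(* forall a, exists y, forall x, x in y <-> forall z in x, z in a *)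
Definition ax_power_set : form :=
  All (Ex (All (Iff (Mem 0 1) (BAll 0 (Mem 0 3))))).

(* (forall x y z, A(x, y) /\ A(x, z) -> y = z) ->
   forall a, exists b, forall y, y in b <-> exists x in a, A(x, y) *)
Definition ax_replacement (A : form) : form :=
  Imp (All (All (All (Imp (And (place [2; 1] 3 A) (place [2; 0] 3 A)) (Eq 1 0)))))
      (All (Ex (All (Iff (Mem 0 1) (BEx 2 (place [0; 1] 4 A)))))).

(* forall a, (forall x in a, exists y, y in x) /\
             (forall x y in a, (exists z in y, z in x) -> x = y) ->
     exists c, forall x in a, exists y, forall z,
       z in x /\ z in c <-> z = y *)
Definition ax_choice : form :=
  All (Imp (And (BAll 0 (Ex (Mem 0 1)))
                (BAll 0 (BAll 1 (Imp (BEx 0 (Mem 0 2)) (Eq 1 0)))))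
    (Ex (BAll 1 (Ex (All (Iff (And (Mem 0 2) (Mem 0 3)) (Eq 0 1))))))).

Inductive ZFC : theory :=
| ZFC_extensionality : ZFC ax_extensionality
| ZFC_empty : ZFC ax_empty
| ZFC_pairing : ZFC ax_pairing
| ZFC_union : ZFC ax_union
| ZFC_power_set : ZFC ax_power_set
| ZFC_infinity : ZFC ax_infinity
| ZFC_foundation : ZFC ax_foundation
| ZFC_separation A : ZFC (univ_closure (ax_separation A))
| ZFC_replacement A : ZFC (univ_closure (ax_replacement A))
| ZFC_choice : ZFC ax_choice.

(** * Countable transitive models

    The universe of sets of the meta-theory is Aczel's type of well-founded
    trees, with bisimilarity as equality. *)

Inductive vset : Type := sup (X : Type) (f : X -> vset).

Fixpoint veq (x y : vset) : Prop :=
  match x, y with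
  | sup X f, sup Y g =>
      (forall i, exists j, veq (f i) (g j)) /\
      (forall j, exists i, veq (f i) (g j))
  end.

Definition vmem (x y : vset) : Prop :=
  match y with sup Y g => exists j, veq x (g j) end.

(* Environments are arbitrary sequences of sets; only quantifiers are
   relativised to [M], which is all that matters for sentences. *)
Fixpoint sat (M : vset) (e : nat -> vset) (A : form) : Prop :=
  let ext x n := match n with 0 => x | S n => e n end in
  match A with
  | Mem x y => vmem (e x) (e y)
  | Eq x y => veq (e x) (e y)
  | Bot => False
  | And A B => sat M e A /\ sat M e B
  | Or A B => sat M e A \/ sat M e B
  | Imp A B => sat M e A -> sat M e B
  | All A => forall x, vmem x M -> sat M (ext x) A
  | Ex A => exists x, vmem x M /\ sat M (ext x) A
  end.

Definition models (M : vset) (T : theory) : Prop :=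
  forall A, T A -> forall e, sat M e A.

Definition transitive_set (M : vset) : Prop :=
  forall x y, vmem x M -> vmem y x -> vmem y M.

Definition countable_set (M : vset) : Prop :=
  exists s : nat -> vset, forall x, vmem x M -> exists n, veq x (s n).

Definition countable_transitive_model (M : vset) (T : theory) : Prop :=
  countable_set M /\ transitive_set M /\ models M T.

(** * The de Jongh property *)

Fixpoint translate (s : nat -> form) (A : pform) : form :=
  match A with
  | PVar p => s p
  | PBot => Bot
  | PAnd A B => And (translate s A) (translate s B)
  | POr A B => Or (translate s A) (translate s B)
  | PImp A B => Imp (translate s A) (translate s B)
  end.

Definition logic_of_theory (T : theory) (A : pform) : Prop :=
  forall s, (forall p, sentence (s p)) -> proves T (translate s A).

Inductive theory_closure (T : theory) (J : pform -> Prop) : theory :=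
| closure_base A : T A -> theory_closure T J A
| closure_logic A s :
    J A -> (forall p, sentence (s p)) -> theory_closure T J (translate s A).

Definition de_jongh_property (T : theory) (J : pform -> Prop) : Prop :=
  forall A, logic_of_theory (theory_closure T J) A <-> J A.

(* Main.v *)
From Stdlib Require Import List Arith Lia ZArith Relations FinFun.
From Stdlib Require Import Classical ClassicalEpsilon FunctionalExtensionality.
Require Import Defs.
Import ListNotations.

(** Every instance of a formula of [J] is a hypothesis of the closed theory, so
    [J] is contained in its logic. For the converse let [A] be provable under
    all substitutions of sentences and let [K] be a finite frame validating
    [J]; since [J] is the logic of such frames, it is enough that [A] is valid
    in [K]. For this a Kripke model of set theory is built in which the truth
    values of sentences are exactly the upsets of [K].

    Over any preorder [P] there is the full Kripke model of names: a name is a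
    family of names, each marked with the node from which on it counts as an
    element. Intuitionistic logic is sound for it ([nforces_sound]) and it
    forces all axioms ([nforces_CZF]), as these transfer from the sets of the
    metatheory. Over [K] itself this model has too few sentences: for instance,
    every maximal node looks like the classical universe, so no sentence
    separates two of them.

    Therefore each node [v] of [K] is replaced by a block: a stack of antichains
    of size [2 ^ rk v], indexed by the integers, where every element of a level
    is below every element of the next ones, and where the whole block of [v]
    is below the block of [w] when [v < w]. Here [rk] is an injective,
    strictly order-reversing map to the naturals. Two things happen.

    - Sentences cannot see inside a block. Moving all levels by the same integer
      is an automorphism of the preorder, and automorphisms preserve the truth
      of sentences ([nforces_automorphism]); together with persistence this
      makes truth constant on blocks ([holds_block]). Since the projection to
      [K] is a bounded morphism, the truth value of a translated propositional
      formula is computed in [K] ([holds_translate]). In particular the model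
      forces all instances of the formulas of [J] ([holds_closure]).

    - Sentences can distinguish blocks. The propositional formula of bounded
      width, quantified over all truth values, is a sentence saying that there
      is no antichain of size [n] above the current node
      ([nforces_width_lt]). As the powers of two grow fast enough, the sentence
      for [2 ^ k] is true in the block of [v] iff [rk v < k] ([holds_width]).
      These truth values form a chain of upsets in which each step adds at
      most one node, and Heyting implications between consecutive members define the
      complement of the principal downset of any node. Intersections of such
      complements are all the upsets ([definable_upset]).

    Hence a valuation on [K] is realised by a substitution of sentences, and
    the provability of the translation of [A] yields the truth of [A] at every
    node of [K]. *)

(** * Names over a preorder *)

Definition scons {T : Type} (x : T) (e : nat -> T) (n : nat) : T :=
  match n with 0 => x | S n => e n end.

Section Names.

Context {P : Type} (le : P -> P -> Prop).
Context (le_refl : forall p, le p p).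
Context (le_trans : forall p q r, le p q -> le q r -> le p r).

Local Notation "p [= q" := (le p q) (at level 70).

(** The member [f i] is present at the nodes above [c i]; so the set of
    nodes at which it is present is an upset without further conditions, and
    arbitrary upsets arise by repeating a member with several nodes. *)
Inductive name : Type := mk (X : Type) (f : X -> name) (c : X -> P).

Fixpoint name_eq (x y : name) (p : P) : Prop :=
  match x, y with
  | mk X f c, mk Y g d =>
      (forall i q, p [= q -> c i [= q ->
         exists j, d j [= q /\ name_eq (f i) (g j) q) /\
      (forall j q, p [= q -> d j [= q ->
         exists i, c i [= q /\ name_eq (f i) (g j) q)
  end.

Definition name_mem (x y : name) (p : P) : Prop :=
  match y with mk Y g d => exists j, d j [= p /\ name_eq x (g j) p end.

Lemma name_eq_refl x p : name_eq x x p.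
Proof.
  revert p; induction x as [X f IH c]; intros p; simpl.
  split; intros i q _ Hi; exists i; auto.
Qed.

Lemma name_eq_sym x y p : name_eq x y p -> name_eq y x p.
Proof.
  revert y p; induction x as [X f IH c]; intros [Y g d] p [H1 H2]; simpl.
  split.
  - intros j q Hq Hj; destruct (H2 j q Hq Hj) as [i [Hi Hij]]; eauto.
  - intros i q Hq Hi; destruct (H1 i q Hq Hi) as [j [Hj Hij]]; eauto.
Qed.

Lemma name_eq_trans x y z p : name_eq x y p -> name_eq y z p -> name_eq x z p.
Proof.
  revert y z p.
  induction x as [X f IH c]; intros [Y g d] [Z h k] p [H1 H2] [H3 H4]; simpl.
  split.
  - intros i q Hq Hi.
    destruct (H1 i q Hq Hi) as [j [Hj Hij]].
    destruct (H3 j q Hq Hj) as [l [Hl Hjl]]; eauto.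
  - intros l q Hq Hl.
    destruct (H4 l q Hq Hl) as [j [Hj Hjl]].
    destruct (H2 j q Hq Hj) as [i [Hi Hij]]; eauto.
Qed.

Lemma name_eq_mono x y p q : p [= q -> name_eq x y p -> name_eq x y q.
Proof.
  destruct x as [X f c], y as [Y g d]; intros Hpq [H1 H2]; split.
  - intros i r Hr; apply H1; eauto.
  - intros j r Hr; apply H2; eauto.
Qed.

Lemma name_mem_mono x y p q : p [= q -> name_mem x y p -> name_mem x y q.
Proof.
  destruct y as [Y g d]; intros Hpq [j [Hj Hx]].
  exists j; split; [eauto | eapply name_eq_mono; eauto].
Qed.

Lemma name_mem_eq_l x x' y p :
  name_eq x x' p -> name_mem x y p -> name_mem x' y p.
Proof.
  destruct y as [Y g d]; intros Hxx' [j [Hj Hx]].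
  exists j; split; [exact Hj |].
  eapply name_eq_trans; [apply name_eq_sym; exact Hxx' | exact Hx].
Qed.

Lemma name_mem_eq_r x y y' p :
  name_eq y y' p -> name_mem x y p -> name_mem x y' p.
Proof.
  destruct y as [Y g d], y' as [Z h k]; intros [H1 _] [j [Hj Hx]].
  destruct (H1 j p (le_refl p) Hj) as [l [Hl Hjl]].
  exists l; split; [exact Hl | eapply name_eq_trans; eauto].
Qed.

(** Equality of names is defined by comparing their listed members only;
    this is the passage to comparing all of their elements. *)
Lemma name_eq_ext x y p :
  (forall q z, p [= q -> name_mem z x q <-> name_mem z y q) -> name_eq x y p.
Proof.
  destruct x as [X f c], y as [Y g d]; intros H; simpl; split.
  - intros i q Hq Hi. apply (H q (f i) Hq).
    exists i; split; [exact Hi | apply name_eq_refl].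
  - intros j q Hq Hj.
    assert (name_mem (g j) (mk X f c) q) as [i [Hi Hji]].
    { apply (H q (g j) Hq); exists j; split; [exact Hj | apply name_eq_refl]. }
    exists i; split; [exact Hi | apply name_eq_sym; exact Hji].
Qed.

(** Members present on a prescribed upset [E i], encoded by one copy of [f i]
    for each node of that upset. *)
Definition comp (X : Type) (f : X -> name) (E : X -> P -> Prop) : name :=
  mk {ir : X * P | E (fst ir) (snd ir)}
     (fun s => f (fst (proj1_sig s))) (fun s => snd (proj1_sig s)).

Lemma mem_comp X f E x p :
  (forall i q r, q [= r -> E i q -> E i r) ->
  name_mem x (comp X f E) p <-> exists i, E i p /\ name_eq x (f i) p.
Proof.
  intros HE; split.
  - intros [[[i r] Hr] [Hle Hx]]; simpl in *; eauto.
  - intros [i [Hi Hx]]; exists (exist _ (i, p) Hi); simpl; auto.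
Qed.

(** * Forcing and soundness *)

(** Names exist at all nodes, so the domain is constant and the universal
    quantifier needs no passage to later nodes. *)
Fixpoint nforces (e : nat -> name) (p : P) (A : form) : Prop :=
  match A with
  | Mem x y => name_mem (e x) (e y) p
  | Eq x y => name_eq (e x) (e y) p
  | Bot => False
  | And A B => nforces e p A /\ nforces e p B
  | Or A B => nforces e p A \/ nforces e p B
  | Imp A B => forall q, p [= q -> nforces e q A -> nforces e q B
  | All A => forall x, nforces (scons x e) p A
  | Ex A => exists x, nforces (scons x e) p A
  end.

Lemma nforces_mono A e p q : p [= q -> nforces e p A -> nforces e q A.
Proof.
  revert e p q; induction A; intros e p q Hpq; simpl.
  - apply name_mem_mono; exact Hpq.
  - apply name_eq_mono; exact Hpq.
  - auto.
  - intros [H1 H2]; eauto.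
  - intros [H1 | H2]; eauto.
  - intros H r Hr; apply H; eauto.
  - intros H x; eauto.
  - intros [x H]; eauto.
Qed.

Lemma nforces_ren A r e e' p :
  (forall n, e' n = e (r n)) -> nforces e p (ren r A) <-> nforces e' p A.
Proof.
  revert r e e' p; induction A; intros r e e' p He; simpl.
  - now rewrite !He.
  - now rewrite !He.
  - tauto.
  - now rewrite (IHA1 _ _ _ p He), (IHA2 _ _ _ p He).
  - now rewrite (IHA1 _ _ _ p He), (IHA2 _ _ _ p He).
  - split; intros H q Hq H1; apply (IHA2 _ _ _ q He), H, (IHA1 _ _ _ q He);
      assumption.
  - split; intros H x; apply (IHA (up r) (scons x e) (scons x e'));
      try apply H; intros [| n]; simpl; auto.
  - split; intros [x H]; exists x; apply (IHA (up r) (scons x e) (scons x e'));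
      try apply H; intros [| n]; simpl; auto.
Qed.

Lemma nforces_agree A e e' p :
  (forall n, n < fvb A -> e n = e' n) -> nforces e p A <-> nforces e' p A.
Proof.
  revert e e' p; induction A; intros e e' p He; simpl in *.
  - rewrite !He by lia; tauto.
  - rewrite !He by lia; tauto.
  - tauto.
  - rewrite (IHA1 e e' p), (IHA2 e e' p); [tauto | |]; intros; apply He; lia.
  - rewrite (IHA1 e e' p), (IHA2 e e' p); [tauto | |]; intros; apply He; lia.
  - split; intros H q Hq H1; apply (IHA2 e e'), H, (IHA1 e e'); auto;
      intros; apply He; lia.
  - split; intros H x; apply (IHA (scons x e) (scons x e')); try apply H;
      intros [| n] Hn; simpl; auto; apply He; lia.
  - split; intros [x H]; exists x; apply (IHA (scons x e) (scons x e'));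
      try apply H; intros [| n] Hn; simpl; auto; apply He; lia.
Qed.

Lemma nforces_eq A e e' p :
  (forall n, name_eq (e n) (e' n) p) -> nforces e p A -> nforces e' p A.
Proof.
  revert e e' p; induction A; intros e e' p He; simpl.
  - intros H; eapply name_mem_eq_r; [apply He |].
    eapply name_mem_eq_l; [apply He | exact H].
  - intros H; eapply name_eq_trans; [apply name_eq_sym, He |].
    eapply name_eq_trans; [exact H | apply He].
  - auto.
  - intros [H1 H2]; eauto.
  - intros [H1 | H2]; eauto.
  - intros H q Hq H1.
    assert (Heq : forall n, name_eq (e n) (e' n) q)
      by (intros n; eapply name_eq_mono; eauto).
    apply (IHA2 e e' q Heq), (H q Hq), (IHA1 e' e q); [| exact H1].
    intros n; apply name_eq_sym, Heq.
  - intros H x; apply (IHA (scons x e)); [| apply H].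
    intros [| n]; simpl; [apply name_eq_refl | apply He].
  - intros [x H]; exists x; apply (IHA (scons x e)); [| apply H].
    intros [| n]; simpl; [apply name_eq_refl | apply He].
Qed.

Lemma nforces_inst A t e p :
  nforces e p (inst A t) <-> nforces (scons (e t) e) p A.
Proof. apply nforces_ren; intros [| n]; reflexivity. Qed.

Lemma nforces_shift A x e p : nforces (scons x e) p (shift A) <-> nforces e p A.
Proof. apply nforces_ren; reflexivity. Qed.

Lemma nforces_sound G A :
  prv G A -> forall e p, (forall B, In B G -> nforces e p B) -> nforces e p A.
Proof.
  assert (Hcons : forall G B e p, nforces e p B ->
            (forall C, In C G -> nforces e p C) ->
            forall C, In C (B :: G) -> nforces e p C)
    by (intros ? ? ? ? ? ? ? [<- | ?]; auto).
  assert (Hshift : forall G x e p, (forall B, In B G -> nforces e p B) ->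
            forall B, In B (map shift G) -> nforces (scons x e) p B).
  { intros G' x e p HG B HB; apply in_map_iff in HB as [C [<- HC]].
    apply nforces_shift; auto. }
  induction 1; intros e p HG; simpl in *.
  - auto.
  - destruct (IHprv e p HG).
  - auto.
  - apply (IHprv e p HG).
  - apply (IHprv e p HG).
  - left; auto.
  - right; auto.
  - destruct (IHprv1 e p HG);
      [apply IHprv2, Hcons | apply IHprv3, Hcons]; auto.
  - intros q Hq HA; apply IHprv, Hcons; auto.
    intros C HC; apply (nforces_mono C e p q Hq); auto.
  - apply (IHprv1 e p HG p (le_refl p)); auto.
  - intros x; apply IHprv, Hshift; auto.
  - apply nforces_inst, IHprv; auto.
  - exists (e t); apply nforces_inst; auto.
  - destruct (IHprv1 e p HG) as [x Hx].
    apply (nforces_shift C x), IHprv2, Hcons;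
      [exact Hx | apply Hshift; exact HG].
  - apply name_eq_refl.
  - apply nforces_inst; apply (nforces_eq A (scons (e s) e)).
    + intros [| n]; simpl; [apply IHprv1; auto | apply name_eq_refl].
    + apply nforces_inst; auto.
Qed.

Lemma nforces_iter_All n A e p :
  nforces e p (Nat.iter n All A) <->
  forall l, nforces (fun k => if k <? n then l k else e (k - n)) p A.
Proof.
  revert A; induction n as [| n IH]; intros A.
  - simpl; split; intros H.
    + intros _; eapply nforces_agree; [| exact H].
      intros k _; simpl; now rewrite Nat.sub_0_r.
    + specialize (H e); eapply nforces_agree; [| exact H].
      intros k _; simpl; now rewrite Nat.sub_0_r.
  - rewrite Nat.iter_succ_r, IH; simpl; split.
    + intros H l.
      eapply nforces_agree; [| exact (H (fun k => l (S k)) (l 0))].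
      intros [| k] _; [reflexivity |]; simpl.
      change (S k <? S n) with (k <? n); reflexivity.
    + intros H l x.
      eapply nforces_agree; [| exact (H (scons x l))].
      intros [| k] _; [reflexivity |]; simpl.
      change (S k <? S n) with (k <? n); reflexivity.
Qed.

Lemma nforces_univ_closure A e p :
  nforces e p (univ_closure A) <-> forall e', nforces e' p A.
Proof.
  unfold univ_closure; rewrite nforces_iter_All; split; intros H l; [| apply H].
  eapply nforces_agree; [| exact (H l)].
  intros n Hn; simpl; apply Nat.ltb_lt in Hn; now rewrite Hn.
Qed.

(** [E] is the environment of a scheme body: [k] entries bound by the
    quantifiers of the scheme, followed by the parameters [e]. *)
Lemma nforces_place l k A E e p :
  (forall n, E (k + n) = e n) ->
  nforces E p (place l k A) <-> nforces (fold_right scons e (map E l)) p A.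
Proof.
  intros He; apply nforces_ren.
  induction l as [| x l IH]; intros [| n]; simpl.
  - symmetry; rewrite <- He; now rewrite Nat.add_0_r.
  - rewrite <- He; f_equal; lia.
  - reflexivity.
  - apply IH.
Qed.

(** * The axioms of set theory *)

Definition index (x : name) : Type := match x with mk X _ _ => X end.

Definition elt (x : name) : index x -> name :=
  match x with mk _ f _ => f end.

Definition at_node (x : name) : index x -> P :=
  match x with mk _ _ c => c end.

Lemma name_memE x y p :
  name_mem x y p <-> exists j, at_node y j [= p /\ name_eq x (elt y j) p.
Proof. destruct y; reflexivity. Qed.

Lemma elt_mem x i p : at_node x i [= p -> name_mem (elt x i) x p.
Proof.
  intros Hi; apply name_memE; exists i; split; [exact Hi | apply name_eq_refl].
Qed.

Lemma nforces_scons_eq A x y e p :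
  name_eq x y p -> nforces (scons x e) p A -> nforces (scons y e) p A.
Proof.
  intros Hxy; apply nforces_eq; intros [| n]; simpl;
    [exact Hxy | apply name_eq_refl].
Qed.

Lemma nforces_scons2_eq A x y x' y' e p :
  name_eq x x' p -> name_eq y y' p ->
  nforces (scons x (scons y e)) p A -> nforces (scons x' (scons y' e)) p A.
Proof.
  intros Hx Hy; apply nforces_eq; intros [| [| n]]; simpl;
    [exact Hx | exact Hy | apply name_eq_refl].
Qed.

Lemma nforces_extensionality e p : nforces e p ax_extensionality.
Proof.
  intros a b q _ H; apply name_eq_ext; intros r z Hr.
  destruct (H z) as [H1 H2]; split; [apply (H1 r Hr) | apply (H2 r Hr)].
Qed.

Definition empty_name : name :=
  mk Empty_set (fun i => match i with end) (fun i => match i with end).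

Lemma nforces_empty e p : nforces e p ax_empty.
Proof. exists empty_name; intros x q _ [[] _]. Qed.

Lemma nforces_pairing e p : nforces e p ax_pairing.
Proof.
  intros a b.
  exists (mk bool (fun i => if i then a else b) (fun _ => p)); intros x.
  split; intros q Hq.
  - intros [[|] [_ H]]; [left | right]; exact H.
  - intros [H | H]; [exists true | exists false]; split; assumption.
Qed.

Lemma nforces_union e p : nforces e p ax_union.
Proof.
  intros a.
  exists (comp {i : index a & index (elt a i)}
            (fun s => elt (elt a (projT1 s)) (projT2 s))
            (fun s r => at_node a (projT1 s) [= r /\
                        at_node (elt a (projT1 s)) (projT2 s) [= r)).
  intros x; split; intros q Hq H.
  - apply mem_comp in H as [[i j] [[Hi Hj] Hx]]; simpl in *.
    + exists (elt a i); split; [apply elt_mem; exact Hi |].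
      apply name_memE; eauto.
    + intros s r t Hrt [H1 H2]; eauto.
  - destruct H as [u [Hu Hx]]; simpl in Hu, Hx.
    apply name_memE in Hu as [i [Hi Hu]].
    apply (name_mem_eq_r _ _ _ _ Hu), name_memE in Hx as [j [Hj Hx]].
    apply mem_comp; [intros s r t Hrt [H1 H2]; eauto |].
    exists (existT _ i j); auto.
Qed.

(** The successor of [x] in which the new member [x] is present from [p]
    on. *)
Definition succ_name (p : P) (x : name) : name :=
  mk (option (index x))
     (fun o => match o with Some i => elt x i | None => x end)
     (fun o => match o with Some i => at_node x i | None => p end).

Lemma mem_succ_name p x z q :
  p [= q -> name_mem z (succ_name p x) q <-> name_mem z x q \/ name_eq z x q.
Proof.
  intros Hq; rewrite (name_memE z x); simpl; split.
  - intros [[i |] [Hi Hz]]; eauto.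
  - intros [[i Hi] | Hz]; [exists (Some i) | exists None]; auto.
Qed.

Definition numeral (p : P) (n : nat) : name :=
  Nat.iter n (succ_name p) empty_name.

(** The numerals of the metatheory suffice, because an empty set equals
    [numeral p 0] and a successor of [numeral p n] equals [numeral p (S n)], by
    extensionality at all nodes above [p]. *)
Lemma nforces_infinity e p : nforces e p ax_infinity.
Proof.
  exists (mk nat (numeral p) (fun _ => p)); intros x; split; intros q Hq H.
  - destruct H as [[| n] [_ Hx]]; simpl in Hx.
    + left; intros z r Hr Hz; simpl in Hz.
      apply (name_mem_eq_r _ _ empty_name) in Hz;
        [destruct Hz as [[] _] | eapply name_eq_mono; eauto].
    + right; exists (numeral p n); split.
      { exists n; split; [exact Hq | apply name_eq_refl]. }
      assert (Hmem : forall z r, q [= r -> name_mem z x r <->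
                name_mem z (numeral p n) r \/ name_eq z (numeral p n) r).
      { intros z r Hr; rewrite <- (mem_succ_name p) by eauto.
        assert (Hxr := name_eq_mono _ _ _ _ Hr Hx).
        split; apply name_mem_eq_r; [| apply name_eq_sym]; exact Hxr. }
      intros z; split; intros r Hr; apply Hmem; exact Hr.
  - destruct H as [Hx | [y [[n [_ Hy]] Hx]]]; simpl in *.
    + exists 0; split; [exact Hq |].
      apply name_eq_ext; intros r z Hr; split.
      * intros Hz; destruct (Hx z r Hr Hz).
      * intros [[] _].
    + exists (S n); split; [exact Hq |].
      apply name_eq_ext; intros r z Hr.
      simpl numeral; rewrite mem_succ_name by eauto.
      assert (Hyr := name_eq_mono _ _ _ _ Hr Hy).
      destruct (Hx z) as [H1 H2]; split.
      * intros Hz; destruct (H1 r Hr Hz) as [H | H]; [left | right].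
        -- apply (name_mem_eq_r _ _ _ _ Hyr H).
        -- apply (name_eq_trans _ _ _ _ H Hyr).
      * apply name_eq_sym in Hyr.
        intros [H | H]; apply (H2 r Hr); [left | right].
        -- apply (name_mem_eq_r _ _ _ _ Hyr H).
        -- apply (name_eq_trans _ _ _ _ H Hyr).
Qed.

Lemma nforces_set_induction A e p : nforces e p (ax_set_induction A).
Proof.
  intros q _ H x.
  rewrite (nforces_place [0] 1 A _ e) by easy.
  enough (Hx : forall r, q [= r -> nforces (scons x e) r A) by auto.
  induction x as [X f IH c]; intros r Hr.
  apply (nforces_place [0] 1 A (scons (mk X f c) e) e r); [easy |].
  apply (H (mk X f c) r Hr); intros y s Hs [i [_ Hy]].
  apply (nforces_place [0] 2 A _ e); [easy |].
  eapply nforces_scons_eq; [apply name_eq_sym; exact Hy | eauto].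
Qed.

Lemma nforces_separation A e p : nforces e p (ax_separation A).
Proof.
  intros a.
  assert (Hmono : forall i q r, q [= r ->
            at_node a i [= q /\ nforces (scons (elt a i) e) q A ->
            at_node a i [= r /\ nforces (scons (elt a i) e) r A)
    by (intros i q r Hr [H1 H2]; split; [| eapply nforces_mono]; eauto).
  exists (comp (index a) (elt a)
            (fun i r => at_node a i [= r /\ nforces (scons (elt a i) e) r A)).
  intros x; split; intros q Hq H.
  - apply mem_comp in H as [i [[Hi HA] Hx]]; [| exact Hmono]; split.
    + apply name_memE; eauto.
    + apply (nforces_place [0] 3 A _ e); [easy |].
      eapply nforces_scons_eq; [apply name_eq_sym; exact Hx | exact HA].
  - destruct H as [Hx HA].
    apply (nforces_place [0] 3 A _ e) in HA; [| easy]; simpl in Hx.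
    apply name_memE in Hx as [i [Hi Hx]].
    apply mem_comp; [exact Hmono |].
    exists i; split; [split |]; auto; eapply nforces_scons_eq; eauto.
Qed.

(** A witness is chosen for each member [elt a i] and each node [r] at which it
    is present. Letting that witness be present from [r] on gives both
    halves of the conclusion: it is related to [elt a i] at all these nodes. *)
Lemma nforces_strong_collection A e p : nforces e p (ax_strong_collection A).
Proof.
  intros a q _ H.
  assert (Hy : forall s : {ir : index a * P | q [= snd ir /\
                             at_node a (fst ir) [= snd ir},
            exists y, nforces (scons (elt a (fst (proj1_sig s))) (scons y e))
                        (snd (proj1_sig s)) A).
  { intros [[i r] [Hr Hi]]; simpl in *.
    destruct (H (elt a i) r Hr (elt_mem a i r Hi)) as [y Hy]; exists y.
    apply (nforces_place [1; 0] 3 A _ e) in Hy; easy. }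
  set (y := fun s => proj1_sig (constructive_indefinite_description _ (Hy s))).
  exists (mk _ y (fun s => snd (proj1_sig s))); split.
  - intros x r Hr Hx; simpl in Hx; apply name_memE in Hx as [i [Hi Hx]].
    set (s := exist _ (i, r) (conj Hr Hi) :
                {ir : index a * P | q [= snd ir /\ at_node a (fst ir) [= snd ir}).
    exists (y s); split.
    + exists s; split; [apply le_refl | apply name_eq_refl].
    + apply (nforces_place [1; 0] 4 A _ e); [easy |].
      apply (nforces_scons_eq _ (elt a i)); [apply name_eq_sym; exact Hx |].
      exact (proj2_sig (constructive_indefinite_description _ (Hy s))).
  - intros z r Hr [s [Hs Hz]]; simpl in Hs.
    destruct (proj2_sig s) as [Hqs Hi].
    exists (elt a (fst (proj1_sig s))); split; [apply elt_mem; simpl; eauto |].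
    apply (nforces_place [0; 1] 4 A _ e); [easy |].
    eapply nforces_scons2_eq;
      [apply name_eq_refl | apply name_eq_sym; exact Hz |].
    eapply nforces_mono; [exact Hs |].
    exact (proj2_sig (constructive_indefinite_description _ (Hy s))).
Qed.

(** The witness is the set of all subsets of [b], which is a name because the
    families of upsets indexed by the members of [b] form a type of the right
    size. The instance for [u] uses the subset of those elements of [b] that are
    related to some element of [a]. *)
Lemma nforces_subset_collection A e p : nforces e p (ax_subset_collection A).
Proof.
  intros a b.
  set (sub := fun D : index b -> P -> Prop =>
         comp (index b) (elt b)
           (fun j r => at_node b j [= r /\ exists r', r' [= r /\ D j r')).
  assert (Hsub : forall D z r, name_mem z (sub D) r <-> exists j,
            (at_node b j [= r /\ exists r', r' [= r /\ D j r') /\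
            name_eq z (elt b j) r).
  { intros D z r; apply mem_comp; intros j s t Hst [H1 [r' [H2 H3]]]; split;
      eauto. }
  exists (mk _ sub (fun _ => p)); intros u q Hq H.
  set (D := fun j r => q [= r /\ exists i, at_node a i [= r /\
              nforces (scons (elt a i) (scons (elt b j) (scons u e))) r A).
  exists (sub D); split.
  { exists D; split; [exact Hq | apply name_eq_refl]. }
  split.
  - intros x r Hr Hx; simpl in Hx.
    destruct (H x r Hr Hx) as [y [Hy HA]]; simpl in Hy.
    apply (nforces_place [1; 0; 2] 6 A _ e) in HA; [| easy].
    exists y; split.
    + apply name_memE in Hy as [j [Hj Hy]], Hx as [i [Hi Hx]].
      apply Hsub; exists j; split; [split |]; auto.
      exists r; split; [apply le_refl |]; split; [exact Hr |].
      exists i; split; [exact Hi |].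
      eapply nforces_scons2_eq; [exact Hx | exact Hy | exact HA].
    + apply (nforces_place [1; 0; 3] 7 A _ e); [easy | exact HA].
  - intros y r Hr Hy; simpl in Hy.
    apply Hsub in Hy as [j [[Hj [r' [Hr' [_ [i [Hi HA]]]]]] Hy]].
    exists (elt a i); split; [apply elt_mem; simpl; eauto |].
    apply (nforces_place [0; 1; 3] 7 A _ e); [easy |].
    eapply nforces_scons2_eq;
      [apply name_eq_refl | apply name_eq_sym; exact Hy |].
    eapply nforces_mono; [exact Hr' | exact HA].
Qed.

Lemma nforces_CZF A e p : CZF A -> nforces e p A.
Proof.
  intros [].
  - apply nforces_extensionality.
  - apply nforces_empty.
  - apply nforces_pairing.
  - apply nforces_union.
  - apply nforces_infinity.
  - apply nforces_univ_closure; intros; apply nforces_set_induction.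
  - apply nforces_univ_closure; intros; apply nforces_separation.
  - apply nforces_univ_closure; intros; apply nforces_strong_collection.
  - apply nforces_univ_closure; intros; apply nforces_subset_collection.
Qed.

(** * Invariance under automorphisms *)

Definition automorphism (t t' : P -> P) : Prop :=
  (forall p q, p [= q -> t p [= t q) /\ (forall p q, p [= q -> t' p [= t' q) /\
  (forall p, t' (t p) = p) /\ (forall p, t (t' p) = p).

Fixpoint rename (t : P -> P) (x : name) : name :=
  match x with mk X f c => mk X (fun i => rename t (f i)) (fun i => t (c i)) end.

Lemma rename_cancel t t' x : (forall p, t (t' p) = p) -> rename t (rename t' x) = x.
Proof.
  intros Ht; induction x as [X f IH c]; simpl; f_equal;
    apply functional_extensionality; auto.
Qed.

(** Stated in one direction because the converse is the same statement for the
    inverse automorphism. *)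
Lemma name_eq_rename_mono t t' x y p :
  automorphism t t' -> name_eq x y p -> name_eq (rename t x) (rename t y) (t p).
Proof.
  intros (Ht & Ht' & H't & Htt').
  assert (Hadj : forall p q, t p [= q -> p [= t' q)
    by (intros r q Hr; rewrite <- (H't r); auto).
  assert (Hadj' : forall p q, p [= t' q -> t p [= q)
    by (intros r q Hr; rewrite <- (Htt' q); auto).
  revert y p; induction x as [X f IH c]; intros [Y g d] p [H1 H2]; simpl; split.
  - intros i q Hq Hi; destruct (H1 i (t' q)) as [j [Hj Hij]]; auto.
    exists j; split; auto; rewrite <- (Htt' q); auto.
  - intros j q Hq Hj; destruct (H2 j (t' q)) as [i [Hi Hij]]; auto.
    exists i; split; auto; rewrite <- (Htt' q); auto.
Qed.

Lemma automorphism_sym t t' : automorphism t t' -> automorphism t' t.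
Proof. unfold automorphism; tauto. Qed.

Lemma name_eq_rename t t' x y p : automorphism t t' ->
  name_eq (rename t x) (rename t y) (t p) <-> name_eq x y p.
Proof.
  intros Ht; split; intros H; [| eapply name_eq_rename_mono; eauto].
  apply automorphism_sym in Ht.
  apply (name_eq_rename_mono _ _ _ _ _ Ht) in H.
  destruct Ht as (_ & _ & H't & Htt').
  now rewrite !rename_cancel, Htt' in H.
Qed.

Lemma name_mem_rename t t' x y p : automorphism t t' ->
  name_mem (rename t x) (rename t y) (t p) <-> name_mem x y p.
Proof.
  intros Ht; destruct y as [Y g d]; simpl.
  split; intros [j [Hj Hx]]; exists j; split.
  - destruct Ht as (_ & Ht' & H't & _).
    rewrite <- (H't (d j)), <- (H't p); auto.
  - apply (name_eq_rename t t'); auto.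
  - apply Ht; exact Hj.
  - apply (name_eq_rename t t'); auto.
Qed.

(** The quantifier cases use that renaming is onto: every name is the renaming
    of its image under the inverse automorphism. *)
Lemma nforces_rename t t' A e e' p : automorphism t t' ->
  (forall n, e' n = rename t (e n)) -> nforces e' (t p) A <-> nforces e p A.
Proof.
  intros Ht; pose proof Ht as (Hmono & Hmono' & H't & Htt').
  revert e e' p; induction A; intros e e' p He; simpl.
  - rewrite !He; apply (name_mem_rename t t'); exact Ht.
  - rewrite !He; apply (name_eq_rename t t'); exact Ht.
  - tauto.
  - now rewrite (IHA1 e e'), (IHA2 e e').
  - now rewrite (IHA1 e e'), (IHA2 e e').
  - split; intros H q Hq H1.
    + apply (IHA2 e e' q He), H, (IHA1 e e' q He); auto.
    + rewrite <- (Htt' q) in H1 |- *.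
      apply (IHA2 e e' (t' q) He), H, (IHA1 e e' (t' q) He); auto.
      rewrite <- (H't p); auto.
  - split; intros H x.
    + apply (IHA (scons x e) (scons (rename t x) e') p); [| apply H].
      intros [| n]; simpl; auto.
    + apply (IHA (scons (rename t' x) e) (scons x e') p); [| apply H].
      intros [| n]; simpl; [symmetry; apply rename_cancel; auto | auto].
  - split; intros [x H].
    + exists (rename t' x).
      apply (IHA (scons (rename t' x) e) (scons x e') p); [| exact H].
      intros [| n]; simpl; [symmetry; apply rename_cancel; auto | auto].
    + exists (rename t x).
      apply (IHA (scons x e) (scons (rename t x) e') p); [| exact H].
      intros [| n]; simpl; auto.
Qed.

Definition empty_env (n : nat) : name := empty_name.

Lemma nforces_automorphism t t' A p : automorphism t t' ->
  nforces empty_env (t p) A <-> nforces empty_env p A.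
Proof.
  intros Ht; apply (nforces_rename t t'); [exact Ht |].
  intros n; unfold empty_env, empty_name; simpl; f_equal;
    apply functional_extensionality; intros [].
Qed.

(** * Bounded width *)

Definition big_or (l : list form) : form := fold_right Or Bot l.
Definition big_and (l : list form) : form := fold_right And (Imp Bot Bot) l.

Lemma nforces_big_or {T} (g : T -> form) l e p :
  nforces e p (big_or (map g l)) <-> exists a, In a l /\ nforces e p (g a).
Proof.
  induction l as [| a l IH]; simpl.
  - split; [tauto | intros [a [[] _]]].
  - rewrite IH; split.
    + intros [H | [b [Hb H]]]; eauto.
    + intros [b [[<- | Hb] H]]; eauto.
Qed.

Lemma nforces_big_and {T} (g : T -> form) l e p :
  nforces e p (big_and (map g l)) <-> forall a, In a l -> nforces e p (g a).
Proof.
  induction l as [| a l IH]; simpl.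
  - split; [intros _ a [] | auto].
  - rewrite IH; split.
    + intros [H1 H2] b [<- | Hb]; auto.
    + auto.
Qed.

Definition inhabited_set (i : nat) : form := Ex (Mem 0 (S i)).

(** The axiom of bounded width of intermediate logic, with its propositional
    variables replaced by the inhabitedness of arbitrary sets. Since the truth
    value of [inhabited_set] can be any upset, its universal closure quantifies
    over all valuations. *)
Definition width_lt (n : nat) : form :=
  univ_closure (big_or (map (fun i =>
    Imp (inhabited_set i)
        (big_or (map inhabited_set (remove Nat.eq_dec i (seq 0 n)))))
    (seq 0 n))).

Definition antichain (n : nat) (y : nat -> P) : Prop :=
  forall i j, i < n -> j < n -> y i [= y j -> i = j.

(** An antichain refutes the formula through the principal upsets of its
    points. Conversely, if every disjunct fails then for each [i] there is a
    node where the [i]-th set is inhabited and the others are not; these nodes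
    are pairwise incomparable. *)
Lemma nforces_width_lt n e p :
  nforces e p (width_lt n) <->
  ~ exists y, antichain n y /\ forall i, i < n -> p [= y i.
Proof.
  unfold width_lt; rewrite nforces_univ_closure; split.
  - intros H [y [Hanti Hy]].
    (* The [i]-th set is inhabited exactly above [y i]. *)
    specialize (H (fun i => mk unit (fun _ => empty_name) (fun _ => y i))).
    apply nforces_big_or in H as [i [Hi H]]; apply in_seq in Hi.
    specialize (H (y i) (Hy i (proj2 Hi))).
    apply nforces_big_or in H as [j [Hj [x [[] [Hle _]]]]].
    + apply in_remove in Hj as [Hj Hij]; apply in_seq in Hj.
      apply Hij, Hanti; lia || exact Hle.
    + exists empty_name, tt; split; [apply le_refl | apply name_eq_refl].
  - intros Hno l; apply NNPP; intros H; apply Hno.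
    assert (Hy : forall i, exists y, i < n ->
              p [= y /\ nforces l y (inhabited_set i) /\
              forall j, j < n -> j <> i -> ~ nforces l y (inhabited_set j)).
    { intros i; apply NNPP; intros Hi; apply H, nforces_big_or.
      destruct (le_lt_dec n i) as [Hn | Hn].
      { destruct Hi; exists p; lia. }
      exists i; split; [apply in_seq; lia |].
      intros q Hq Hinh; apply nforces_big_or, NNPP; intros Hnone.
      apply Hi; exists q; intros _; split; [exact Hq |]; split; [exact Hinh |].
      intros j Hj Hji Hinhj; apply Hnone; exists j; split; [| exact Hinhj].
      apply in_in_remove; [exact Hji | apply in_seq; lia]. }
    set (y := fun i => proj1_sig (constructive_indefinite_description _ (Hy i))).
    assert (Hspec := fun i =>
      proj2_sig (constructive_indefinite_description _ (Hy i))).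
    exists y; split.
    + intros i j Hi Hj Hij; apply NNPP; intros Hne.
      destruct (Hspec i Hi) as (_ & Hinh & _).
      destruct (Hspec j Hj) as (_ & _ & Hnot).
      apply (Hnot i Hi Hne), (nforces_mono _ _ _ _ Hij), Hinh.
    + intros i Hi; apply (Hspec i Hi).
Qed.

End Names.

Arguments name : clear implicits.

Lemma fvb_iter_All n A : fvb (Nat.iter n All A) = fvb A - n.
Proof. induction n; simpl; lia. Qed.

Lemma sentence_univ_closure A : sentence (univ_closure A).
Proof. unfold sentence, univ_closure; rewrite fvb_iter_All; lia. Qed.

Lemma sentence_big_and l :
  (forall A, In A l -> sentence A) -> sentence (big_and l).
Proof.
  unfold sentence; induction l as [| A l IH]; simpl; intros H; [reflexivity |].
  rewrite (H A), IH by auto; reflexivity.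
Qed.

(** * Ranking a finite frame *)

Lemma filter_length_strict {T} (P Q : T -> bool) l a :
  (forall x, P x = true -> Q x = true) ->
  In a l -> P a = false -> Q a = true ->
  length (filter P l) < length (filter Q l).
Proof.
  intros HPQ Ha HPa HQa.
  assert (Hle : forall l', length (filter P l') <= length (filter Q l')).
  { induction l' as [| x l' IH]; simpl; [lia |].
    specialize (HPQ x); destruct (P x), (Q x); simpl; lia. }
  induction l as [| x l IH]; [destruct Ha |]; simpl.
  destruct Ha as [-> | Ha].
  - rewrite HPa, HQa; simpl; specialize (Hle l); lia.
  - specialize (IH Ha); specialize (HPQ x); destruct (P x), (Q x); simpl; lia.
Qed.

(** The number of nodes above [v] is strictly order-reversing; injectivity is
    obtained by adding the position in an enumeration as a lower-order
    digit. *)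
Lemma finite_frame_ranking (K : frame) : Finite K ->
  exists rk : K -> nat, (forall v w, rk v = rk w -> v = w) /\
    (forall v w, fle v w -> v <> w -> rk w < rk v).
Proof.
  intros [l Hl]; destruct (fle_order K) as [Hrefl Htrans Hanti].
  assert (Hpos : forall v : K, exists n, nth_error l n = Some v)
    by (intros v; apply In_nth_error, Hl).
  set (pos := fun v => proj1_sig (constructive_indefinite_description _ (Hpos v))).
  assert (Hposv : forall v, nth_error l (pos v) = Some v) by
    (intros v; exact (proj2_sig (constructive_indefinite_description _ (Hpos v)))).
  assert (Hlt : forall v, pos v < length l)
    by (intros v; apply nth_error_Some; rewrite Hposv; discriminate).
  set (above := fun v w : K =>
         if excluded_middle_informative (fle v w) then true else false).
  assert (Habove : forall v w, above v w = true <-> fle v w).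
  { intros v w; unfold above.
    destruct (excluded_middle_informative (fle v w)); intuition discriminate. }
  exists (fun v => length (filter (above v) l) * length l + pos v); split.
  - intros v w H; specialize (Hposv v) as Hv; specialize (Hposv w) as Hw.
    assert (Hpp : pos v = pos w).
    { rewrite !(Nat.mul_comm _ (length l)) in H.
      apply (Nat.div_mod_unique _ _ _ _ _ (Hlt v) (Hlt w) H). }
    rewrite Hpp in Hv; congruence.
  - intros v w Hvw Hne.
    assert (length (filter (above w) l) < length (filter (above v) l)).
    { apply (filter_length_strict _ _ _ v).
      - intros x; rewrite !Habove; eauto.
      - apply Hl.
      - apply Bool.not_true_is_false; rewrite Habove; auto.
      - apply Habove, Hrefl. }
    specialize (Hlt w); nia.
Qed.

(** * Blowing up the nodes of a frame *)

Section BlowUp.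

Context (K : frame) (rk : K -> nat).

(** Levels range over the integers rather than the naturals, so that the moves
    between levels are invertible. *)
Record point : Type := {
  block : K;
  level : Z;
  idx : nat;
  idx_lt : idx < 2 ^ rk block
}.

(** This is only a preorder: [idx_lt] is not compared. *)
Definition ple (x y : point) : Prop :=
  (fle (block x) (block y) /\ block x <> block y) \/
  (block x = block y /\
   ((level x < level y)%Z \/ (level x = level y /\ idx x = idx y))).

Lemma fle_refl (v : K) : fle v v.
Proof. apply (ord_refl _ _ (fle_order K)). Qed.

Lemma ple_refl x : ple x x.
Proof. right; auto. Qed.

Lemma ple_trans x y z : ple x y -> ple y z -> ple x z.
Proof.
  destruct (fle_order K) as [_ Htrans Hanti].
  intros [[H1 N1] | [E1 H1]] [[H2 N2] | [E2 H2]].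
  - left; split; [eapply Htrans; eauto |].
    intros E; rewrite E in H1; apply N2, Hanti; assumption.
  - left; rewrite <- E2; auto.
  - left; rewrite E1; auto.
  - right; split; [congruence |]; intuition (lia || congruence).
Qed.

Lemma ple_block x y : ple x y -> fle (block x) (block y).
Proof. intros [[H _] | [-> _]]; [exact H | apply fle_refl]. Qed.

Lemma two_pow_pos n : 0 < 2 ^ n.
Proof. apply Nat.neq_0_lt_0, Nat.pow_nonzero; discriminate. Qed.

Definition base_point (v : K) : point :=
  {| block := v; level := 0; idx := 0; idx_lt := two_pow_pos (rk v) |}.

(** With [ple_block], this says that the projection to [K] is a bounded
    morphism. *)
Lemma ple_lift x w : fle (block x) w -> exists y, ple x y /\ block y = w.
Proof.
  intros Hw; destruct (classic (block x = w)) as [E | N].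
  - exists x; split; [apply ple_refl | exact E].
  - exists (base_point w); split; [left; auto | reflexivity].
Qed.

Definition lift_by (d : Z) (x : point) : point :=
  {| block := block x; level := level x + d; idx := idx x; idx_lt := idx_lt x |}.

Lemma lift_by_automorphism d : automorphism ple (lift_by d) (lift_by (- d)).
Proof.
  unfold automorphism, ple; repeat split; simpl.
  - intros x y; intuition lia.
  - intros x y; intuition lia.
  - intros [v k i Hi]; unfold lift_by; simpl; f_equal; lia.
  - intros [v k i Hi]; unfold lift_by; simpl; f_equal; lia.
Qed.

Local Notation holds x A := (nforces ple empty_env x A).

(** Lifting [y] by a suitable amount puts it one level above [x], where [A]
    holds by persistence. *)
Lemma holds_block A x y : block x = block y -> holds x A -> holds y A.
Proof.
  intros E H.
  apply (nforces_automorphism ple _ _ A y (lift_by_automorphism (level x - level y + 1))).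
  apply (nforces_mono ple ple_trans A _ x); [| exact H].
  right; simpl; split; [exact E | left; lia].
Qed.

(** Upsets of [K] embed into upsets of points by inverse images along the
    projection, and this embedding preserves implication because the projection
    is a bounded morphism. *)
Lemma holds_translate s V A x :
  (forall p y, holds y (s p) <-> V p (block y)) ->
  holds x (translate s A) <-> forces V (block x) A.
Proof.
  intros Hs; revert x; induction A; intros x; simpl.
  - apply Hs.
  - tauto.
  - now rewrite IHA1, IHA2.
  - now rewrite IHA1, IHA2.
  - split; intros H.
    + intros w Hw; destruct (ple_lift x w Hw) as [y [Hxy <-]].
      rewrite <- IHA1, <- IHA2; auto.
    + intros y Hy; rewrite IHA1, IHA2; apply H, ple_block, Hy.
Qed.

(** The truth values of the substituted sentences form a valuation on [K], to
    which the validity of [B] in [K] is applied. *)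
Lemma holds_closure (J : pform -> Prop) A x :
  (forall B, J B -> valid K B) -> proves (theory_closure CZF J) A -> holds x A.
Proof.
  intros HJ [G [HG HA]].
  apply (nforces_sound ple ple_refl ple_trans G A HA).
  intros B HB; destruct (HG B HB) as [B0 HB0 | B0 s HB0 _].
  - apply (nforces_CZF ple ple_refl ple_trans); exact HB0.
  - apply (holds_translate s (fun p v => forall y, block y = v -> holds y (s p))).
    + intros p y; split; [| auto].
      intros H z E; apply (holds_block _ y); auto.
    + apply HJ; [exact HB0 |].
      intros p w v Hw Hle y E.
      destruct (ple_lift (base_point w) v Hle) as [z [Hz Ez]].
      apply (holds_block _ z); [congruence |].
      apply (nforces_mono ple ple_trans _ _ _ _ Hz), Hw; reflexivity.
Qed.

(** * Definability of upsets *)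

Context (rk_inj : forall v w, rk v = rk w -> v = w).
Context (rk_anti : forall v w, fle v w -> v <> w -> rk w < rk v).

(** An antichain above [x] which meets the block of [x] stays in it, and
    within a single level. Otherwise it lies in blocks of smaller rank, and these
    are too small: the point with index [i] in a block of rank [r] is coded by
    [2 ^ r + i], a number that determines [r] and [i] and is below
    [2 ^ rk (block x)]. *)
Lemma antichain_bound n x y :
  antichain ple n y -> (forall i, i < n -> ple x (y i)) -> n <= 2 ^ rk (block x).
Proof.
  intros Hanti Hy.
  set (code := fun i => if excluded_middle_informative (block (y i) = block x)
                        then idx (y i) else 2 ^ rk (block (y i)) + idx (y i)).
  rewrite <- (length_seq n 0), <- (length_map code (seq 0 n)).
  rewrite <- (length_seq (2 ^ rk (block x)) 0).
  apply NoDup_incl_length.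
  - assert (Hlvl : forall i j, i < n -> j < n -> block (y i) = block (y j) ->
              idx (y i) = idx (y j) -> i = j).
    { intros i j Hi Hj Eb Ei.
      destruct (Z.lt_trichotomy (level (y i)) (level (y j))) as [H | [H | H]].
      - apply Hanti; auto; right; auto.
      - apply Hanti; auto; right; auto.
      - symmetry; apply Hanti; auto; right; auto. }
    assert (Hmix : forall i j, i < n -> j < n -> block (y i) = block x ->
              block (y j) <> block x -> i = j).
    { intros i j Hi Hj Ei Nj; apply Hanti; auto; left; rewrite Ei; split.
      - apply ple_block; auto.
      - auto. }
    apply NoDup_nth with (d := 0).
    rewrite length_map, length_seq; intros i j Hi Hj.
    rewrite !(nth_indep _ 0 (code 0)) by now rewrite length_map, length_seq.
    rewrite !map_nth, !seq_nth by assumption; simpl; unfold code.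
    destruct (excluded_middle_informative (block (y i) = block x)) as [Ei | Ni],
      (excluded_middle_informative (block (y j) = block x)) as [Ej | Nj]; intros E.
    + apply Hlvl; congruence.
    + apply Hmix; auto.
    + symmetry; apply Hmix; auto.
    + assert (rk (block (y i)) = rk (block (y j))) as Erk.
      { assert (Hpow : forall u v, idx v < 2 ^ rk (block v) ->
                  2 ^ rk (block u) + idx u = 2 ^ rk (block v) + idx v ->
                  ~ rk (block v) < rk (block u)).
        { intros u v Hv Huv Hlt.
          apply (Nat.pow_le_mono_r 2) in Hlt; simpl in Hlt; lia. }
        specialize (Hpow (y i) (y j) (idx_lt _) E) as H1.
        specialize (Hpow (y j) (y i) (idx_lt _) (eq_sym E)) as H2; lia. }
      apply Hlvl; auto; rewrite Erk in E; lia.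
  - intros c Hc; apply in_map_iff in Hc as [i [<- Hi]].
    apply in_seq in Hi; apply in_seq; split; [lia |]; unfold code; simpl.
    specialize (idx_lt (y i)) as Hidx.
    destruct (excluded_middle_informative (block (y i) = block x)) as [E | N].
    + now rewrite E in Hidx.
    + assert (Hlt : rk (block (y i)) < rk (block x))
        by (apply rk_anti; [apply ple_block, Hy; lia | auto]).
      apply (Nat.pow_le_mono_r 2) in Hlt; simpl in Hlt; lia.
Qed.

(** If [k <= rk (block x)] then the next level of the block of [x] contains an
    antichain of size [2 ^ k]. *)
Lemma holds_width x k : holds x (width_lt (2 ^ k)) <-> rk (block x) < k.
Proof.
  rewrite (nforces_width_lt ple ple_refl ple_trans); split.
  - intros Hno; apply Nat.nle_gt; intros Hk; apply Hno.
    apply (Nat.pow_le_mono_r 2) in Hk; [| lia].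
    exists (fun i =>
      match lt_dec i (2 ^ rk (block x)) with
      | left Hi => {| block := block x; level := level x + 1; idx := i; idx_lt := Hi |}
      (* Beyond the required size the value is arbitrary. *)
      | right _ => x
      end); split.
    + intros i j Hi Hj.
      destruct (lt_dec i _) as [Hi' | Hi'], (lt_dec j _) as [Hj' | Hj']; try lia.
      intros [[_ []] | [_ [H | [_ H]]]]; simpl in *; [reflexivity | lia | exact H].
    + intros i Hi; destruct (lt_dec i _) as [Hi' | Hi']; [| lia].
      right; simpl; split; [reflexivity | left; lia].
  - intros Hk [y [Hanti Hy]].
    assert (Hle := antichain_bound _ x y Hanti Hy).
    assert (Hlt := Nat.pow_lt_mono_r 2 _ _ Nat.lt_1_2 Hk); lia.
Qed.

Definition not_below (v : K) : form :=
  Imp (width_lt (2 ^ S (rk v))) (width_lt (2 ^ rk v)).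

(** The antecedent holds on the blocks of rank at most [rk v], the consequent on
    those of smaller rank. So the implication fails at [x] iff some block of
    rank [rk v], which is the block of [v], lies above. *)
Lemma holds_not_below x v : holds x (not_below v) <-> ~ fle (block x) v.
Proof.
  unfold not_below; split.
  - intros H Hv; destruct (ple_lift x v Hv) as [y [Hy <-]].
    specialize (H y Hy); rewrite !holds_width in H; lia.
  - intros Hv y Hy; rewrite !holds_width; intros Hlt.
    destruct (Nat.eq_dec (rk (block y)) (rk v)) as [E | N]; [| lia].
    destruct Hv; rewrite <- (rk_inj _ _ E); apply ple_block, Hy.
Qed.

(** An upset is the intersection of the complements of the principal downsets
    of the nodes outside it. *)
Lemma definable_upset (l : list K) (U : K -> Prop) :
  Full l -> (forall v w, U v -> fle v w -> U w) ->
  exists A, sentence A /\ forall x, holds x A <-> U (block x).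
Proof.
  intros Hl HU.
  set (outside := filter (fun v =>
         if excluded_middle_informative (U v) then false else true) l).
  assert (Hout : forall v, In v outside <-> ~ U v).
  { intros v; unfold outside; rewrite filter_In.
    specialize (Hl v); destruct (excluded_middle_informative (U v));
      intuition congruence. }
  exists (big_and (map not_below outside)); split.
  - apply sentence_big_and; intros A HA.
    apply in_map_iff in HA as [v [<- _]].
    unfold sentence; simpl.
    unfold width_lt; now rewrite !sentence_univ_closure.
  - intros x; rewrite nforces_big_and; split.
    + intros H; apply NNPP; intros Hx.
      apply (proj1 (holds_not_below x (block x))); [apply H, Hout, Hx |].
      apply fle_refl.
    + intros Hx v Hv; apply holds_not_below; intros Hle.
      apply Hout in Hv; apply Hv, (HU _ _ Hx Hle).
Qed.

End BlowUp.

(** A valuation that refutes the formula in [K] would be given by sentences,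
    and the model over the blown-up frame would refute the corresponding
    instance. *)
Lemma logic_of_closure_valid (K : frame) (J : pform -> Prop) A :
  Finite K -> (forall B, J B -> valid K B) ->
  logic_of_theory (theory_closure CZF J) A -> valid K A.
Proof.
  intros HK HJ HA V HV v.
  destruct (finite_frame_ranking K HK) as [rk [Hinj Hanti]].
  destruct HK as [l Hl].
  assert (Hs : forall p, exists B, sentence B /\ forall x : point K rk,
            nforces (ple K rk) empty_env x B <-> V p (block K rk x)).
  { intros p; apply (definable_upset K rk Hinj Hanti l); [exact Hl |].
    intros u w; apply HV. }
  destruct (choice _ Hs) as [s Hsp].
  apply (holds_translate K rk s V A (base_point K rk v));
    [intros p; apply Hsp |].
  apply (holds_closure K rk J); [exact HJ |].
  apply HA; intros p; apply Hsp.
Qed.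

Theorem corollary37
  (ctm : exists M : vset, countable_transitive_model M ZFC)
  (J : pform -> Prop)
  (J_intermediate : intermediate_logic J)
  (J_characterised :
     exists C : frame -> Prop,
       (forall K, C K -> is_tree K /\ FinFun.Finite K) /\ characterises C J) :
  de_jongh_property CZF J.
Proof.
  intros A; split.
  - intros HA; destruct J_characterised as [C [HC HCJ]].
    apply HCJ; intros K HK.
    apply (logic_of_closure_valid K J); [apply HC, HK | | exact HA].
    intros B HB; apply HCJ; assumption.
  - intros HA s Hs; exists [translate s A]; split.
    + intros B [<- | []]; constructor; assumption.
    + apply Hyp; left; reflexivity.
Qed.
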